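(* The structures $(\overline{\mathbb R},W_1)$ and $(\overline{\mathbb R},\Gamma{\restriction}(0,\infty))$ are interdefinable, where $W_1\colon(0,\infty)\to\mathbb R$ is given by $W_1(x)=\prod_{n>0}\left(1+\frac{x}{n}\right)e^{-x/n}$ and $\Gamma$ is the Gamma function.
   Context: $\overline{\mathbb R}=(\mathbb R,+,\cdot,(r)_{r\in\mathbb R})$ is the real field with a constant for each real number. $(\overline{\mathbb R},f)$ denotes its expansion by the function $f$ (identified with its graph). Two structures on $\mathbb R$ are interdefinable if they have the same first-order definable sets (parameters from $\mathbb R$ allowed). *)

(* Defs.v *)
From HB Require Import structures.
From mathcomp Require Import all_boot all_order all_algebra.
From mathcomp Require Import all_classical all_reals all_analysis.

Set Implicit Arguments.
Unset Strict Implicit.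
Unset Printing Implicit Defensive.

Import Order.TTheory GRing.Theory Num.Theory.
Import numFieldNormedType.Exports.

Local Open Scope classical_set_scope.
Local Open Scope ring_scope.

(* A first-order structure with universe [M], bundled with its signature.
   The cartesian power M^n is ['I_n -> M]; constants are 0-ary functions. *)
Record structure (M : Type) := Structure {
  fsym : Type;
  farity : fsym -> nat;
  finterp : forall s : fsym, ('I_(farity s) -> M) -> M;
  rsym : Type;
  rarity : rsym -> nat;
  rinterp : forall s : rsym, set ('I_(rarity s) -> M) }.

(* [term A n] and [formula A n] have their free variables among x_0, ...,
   x_(n-1), and may use every element of the universe as a parameter. *)
Inductive term (M : Type) (A : structure M) (n : nat) : Type :=
| Var of 'I_n
| Param of M
| App (s : fsym A) of ('I_(farity s) -> term A n).

Inductive formula (M : Type) (A : structure M) : nat -> Type :=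
| Equal n of term A n & term A n : formula A n
| Rel n (s : rsym A) of ('I_(rarity s) -> term A n) : formula A n
| Neg n of formula A n : formula A n
| Conj n of formula A n & formula A n : formula A n
| Exists n of formula A n.+1 : formula A n.

Fixpoint eval (M : Type) (A : structure M) (n : nat) (v : 'I_n -> M)
    (t : term A n) : M :=
  match t with
  | Var i => v i
  | Param a => a
  | App s ts => finterp (fun i => eval v (ts i))
  end.

(* The variable bound by [Exists] is x_0; the others are shifted by one. *)
Definition env_cons (M : Type) (n : nat) (a : M) (v : 'I_n -> M) :
    'I_n.+1 -> M :=
  fun i => if unlift ord0 i is Some j then v j else a.

Fixpoint holds (M : Type) (A : structure M) (n : nat) (f : formula A n) :
    ('I_n -> M) -> Prop :=
  match f in formula _ n0 return ('I_n0 -> M) -> Prop with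
  | Equal _ t u => fun v => eval v t = eval v u
  | Rel _ s ts => fun v => rinterp (fun i => eval v (ts i))
  | Neg _ g => fun v => ~ holds g v
  | Conj _ g h => fun v => holds g v /\ holds h v
  | Exists _ g => fun v => exists a : M, holds g (env_cons a v)
  end.

Definition definable (M : Type) (A : structure M) (n : nat)
    (X : set ('I_n -> M)) : Prop :=
  exists f : formula A n, X = [set v | holds f v].

Definition interdefinable (M : Type) (A B : structure M) : Prop :=
  forall (n : nat) (X : set ('I_n -> M)), definable A X <-> definable B X.

Inductive field_sym (R : Type) : Type :=
| FAdd
| FMul
| FConst of R.

Definition field_arity (R : Type) (s : field_sym R) : nat :=
  match s with FAdd => 2 | FMul => 2 | FConst _ => 0 end.

Definition field_interp (R : realType) (s : field_sym R) :
    ('I_(field_arity s) -> R) -> R :=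
  match s return ('I_(field_arity s) -> R) -> R with
  | FAdd => fun v => v ord0 + v ord_max
  | FMul => fun v => v ord0 * v ord_max
  | FConst r => fun=> r
  end.

(* The graph of the restriction of [f] to [D]. *)
Definition graph_on (T U : Type) (D : set T) (f : T -> U) : set (T * U) :=
  [set p | D p.1 /\ p.2 = f p.1].

(* The real field with a constant for each real number, expanded by the
   function with domain [D] given there by [f]; a partial function is added
   as a binary relation symbol denoting its graph. *)
Definition real_field_with (R : realType) (D : set R) (f : R -> R) :
    structure R :=
  {| fsym := field_sym R;
     farity := @field_arity R;
     finterp := @field_interp R;
     rsym := unit;
     rarity := fun=> 2;
     rinterp := fun _ (v : 'I_2 -> R) => graph_on D f (v ord0, v ord_max) |}.

(* Only used for x > 0, where the product converges. *)
Definition W1 (R : realType) (x : R) : R :=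
  limn (fun N : nat =>
    \prod_(1 <= n < N.+1) ((1 + x / n%:R) * expR (- (x / n%:R)))).

(* Euler's integral; only used for x > 0, where the integral is finite. *)
Definition Gamma (R : realType) (x : R) : R :=
  Rintegral (@lebesgue_measure R) `]0, +oo[
    (fun t : R => t `^ (x - 1) * expR (- t)).

(* Main.v *)
Require Import Defs.
From mathcomp Require Import all_boot all_order all_algebra.
From mathcomp Require Import all_classical all_reals all_analysis.
From mathcomp Require Import measurable_realfun.
From mathcomp Require Import ring lra.

(* Weierstrass' formula W1 x * (x * exp (c * x) * Gamma x) = 1, with c the
   Euler-Mascheroni constant, makes W1 and Gamma definable from each other as
   soon as a |-> exp (c * a), a > 0, is definable from each of them. It is, as
   a limit: Gamma (y + a) / (Gamma y * y ^ a) tends to 1 as y -> +oo, so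
     Gamma (t y + a) Gamma y / (Gamma (y + a) Gamma (t y)) --> t ^ a,
   and the same expression in W1 tends to t ^ (- a); take t = exp c, resp.
   t = exp (- c). Both the asymptotics and Weierstrass' formula follow from
   Gamma (x + 1) = x Gamma x and Gamma (y + a) <= y ^ a Gamma y, 0 <= a <= 1. *)

Set Implicit Arguments.
Unset Strict Implicit.
Unset Printing Implicit Defensive.

Import Order.TTheory GRing.Theory Num.Theory.
Import numFieldNormedType.Exports.

Local Open Scope classical_set_scope.
Local Open Scope ring_scope.

(** * Definable sets and functions *)

Section Definability.
Context {M : Type} (A : structure M).

Definition env_tail n (v : 'I_n.+1 -> M) : 'I_n -> M :=
  fun i => v (lift ord0 i).

Lemma env_cons_tail n (v : 'I_n.+1 -> M) :
  env_cons (v ord0) (env_tail v) = v.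
Proof.
apply/funext => i; rewrite /env_cons /env_tail.
by case: unliftP => [j ->|->].
Qed.

Lemma env_cons_ord0 n a (v : 'I_n -> M) : env_cons a v ord0 = a.
Proof. by rewrite /env_cons unlift_none. Qed.

Lemma env_tail_cons n a (v : 'I_n -> M) : env_tail (env_cons a v) = v.
Proof. by apply/funext => i; rewrite /env_tail /env_cons liftK. Qed.

Lemma definable_not n (X : set ('I_n -> M)) :
  definable A X -> definable A [set v | ~ X v].
Proof. by move=> [f ->]; exists (Neg f). Qed.

Lemma definable_and n (X Y : set ('I_n -> M)) :
  definable A X -> definable A Y -> definable A [set v | X v /\ Y v].
Proof. by move=> [f ->] [g ->]; exists (Conj f g). Qed.

Lemma definable_or n (X Y : set ('I_n -> M)) :
  definable A X -> definable A Y -> definable A [set v | X v \/ Y v].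
Proof.
move=> dX dY.
have := definable_not (definable_and (definable_not dX) (definable_not dY)).
congr definable; apply/seteqP; split=> v /=; last by tauto.
by move=> /not_andP[/contrapT|/contrapT]; [left|right].
Qed.

Lemma definable_imp n (X Y : set ('I_n -> M)) :
  definable A X -> definable A Y -> definable A [set v | X v -> Y v].
Proof.
move=> dX dY; have := definable_or (definable_not dX) dY.
congr definable; apply/seteqP; split=> v /=; first by tauto.
by move=> XY; case: (pselect (X v)); tauto.
Qed.

(** With [Q] taking the quantified element as a separate argument, definability proofs can follow
    the logical shape of a set without any formula being written down. *)
Lemma definable_exists n (Q : M -> set ('I_n -> M)) :
  definable A [set w | Q (w ord0) (env_tail w)] ->
  definable A [set v | exists a, Q a v].
Proof.
move=> [f Qf]; exists (Exists f); apply/seteqP.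
have E a v : Q a v = holds f (env_cons a v).
  have := congr1 (fun X : set _ => X (env_cons a v)) Qf.
  by rewrite /= env_cons_ord0 env_tail_cons.
by split=> v /= [a]; [rewrite E|rewrite -E] => Qa; exists a.
Qed.

Lemma definable_forall n (Q : M -> set ('I_n -> M)) :
  definable A [set w | Q (w ord0) (env_tail w)] ->
  definable A [set v | forall a, Q a v].
Proof.
move=> /definable_not /(@definable_exists _ (fun a v => ~ Q a v)).
move=> /definable_not; congr definable; apply/seteqP; split=> v /=.
  by move=> nQ a; apply: contrapT => nQa; apply: nQ; exists a.
by move=> Qv [a]; apply.
Qed.

Fixpoint term_rename n m (r : 'I_n -> 'I_m) (t : term A n) : term A m :=
  match t with
  | Var i => Var A (r i)
  | Param a => Param A m a
  | App s ts => App (fun i => term_rename r (ts i))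
  end.

Lemma eval_rename n m (r : 'I_n -> 'I_m) (t : term A n) v :
  Defs.eval v (term_rename r t) = Defs.eval (v \o r) t.
Proof.
by elim: t => //= s ts IH; congr finterp; apply/funext => i; rewrite IH.
Qed.

Definition lift_rename n m (r : 'I_n -> 'I_m) : 'I_n.+1 -> 'I_m.+1 :=
  fun i => if unlift ord0 i is Some j then lift ord0 (r j) else ord0.

Lemma env_cons_rename n m (r : 'I_n -> 'I_m) a (v : 'I_m -> M) :
  env_cons a v \o lift_rename r = env_cons a (v \o r).
Proof.
apply/funext => i; rewrite /env_cons /lift_rename /=.
by case: (unlift ord0 i) => [j|]; rewrite ?liftK ?unlift_none.
Qed.

(** Induction on the formula, with [m] and [r] kept general: under a quantifier the renaming becomes
    [lift_rename r], which fixes the bound [x_0]. *)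
Lemma definable_rename n m (r : 'I_n -> 'I_m) (X : set ('I_n -> M)) :
  definable A X -> definable A [set v : 'I_m -> M | X (v \o r)].
Proof.
move=> [f ->{X}]; elim: f m r => {n} [n t u|n s ts|n f IH|n f IHf g IHg|n f IH].
- move=> m r; exists (Equal (term_rename r t) (term_rename r u)).
  by apply/seteqP; split=> v /=; rewrite !eval_rename.
- move=> m r; exists (Rel (fun i => term_rename r (ts i))).
  have E v : (fun i => Defs.eval v (term_rename r (ts i))) =
             (fun i => Defs.eval (v \o r) (ts i)).
    by apply/funext => i; rewrite eval_rename.
  by apply/seteqP; split=> v /=; rewrite E.
- by move=> m r; apply: definable_not; exact: IH.
- by move=> m r; apply: definable_and; [exact: IHf|exact: IHg].
- move=> m r.
  apply: (@definable_exists _ (fun a v => holds f (env_cons a (v \o r)))).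
  have := IH _ (lift_rename r); congr definable.
  by apply/seteqP; split=> w /=; rewrite -env_cons_rename env_cons_tail.
Qed.

Definition definable_fun n (F : ('I_n -> M) -> M) :=
  definable A [set w : 'I_n.+1 -> M | w ord0 = F (env_tail w)].

Lemma definable_fun_rename n m (r : 'I_n -> 'I_m) (F : ('I_n -> M) -> M) :
  definable_fun F -> definable_fun (fun v => F (v \o r)).
Proof.
move=> /(definable_rename (lift_rename r)).
have E (w : 'I_m.+1 -> M) :
    env_tail (w \o lift_rename r) = env_tail w \o r.
  by apply/funext => i; rewrite /env_tail /lift_rename /= liftK.
by congr definable; apply/seteqP; split=> w /=;
  rewrite E /lift_rename unlift_none.
Qed.

Lemma definable_fun_tail n (F : ('I_n -> M) -> M) :
  definable_fun F -> definable_fun (fun v => F (env_tail v)).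
Proof. exact: definable_fun_rename. Qed.

Lemma definable_eq n (F G : ('I_n -> M) -> M) :
  definable_fun F -> definable_fun G -> definable A [set v | F v = G v].
Proof.
move=> dF dG.
have : definable A [set v | exists a, a = F v /\ a = G v].
  apply: (@definable_exists _ (fun a v => a = F v /\ a = G v)).
  exact: definable_and.
congr definable; apply/seteqP; split=> v /= => [[a [-> ->//]]|->].
by exists (G v).
Qed.

Lemma definable_fun_var n (i : 'I_n) : definable_fun (fun v => v i).
Proof. by exists (Equal (Var A ord0) (Var A (lift ord0 i))). Qed.

Lemma definable_fun_cst n (a : M) : definable_fun (fun _ : 'I_n -> M => a).
Proof. by exists (Equal (Var A ord0) (Param A n.+1 a)). Qed.

(** [F] and [G] need not be given by terms, so their values are named by two quantifiers instead of
    being substituted. *)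
Lemma definable_comp2 n (P : M -> M -> Prop) (F G : ('I_n -> M) -> M) :
  definable A [set v : 'I_2 -> M | P (v ord0) (v ord_max)] ->
  definable_fun F -> definable_fun G -> definable A [set v | P (F v) (G v)].
Proof.
move=> dP dF dG.
have : definable A
    [set v | exists a, a = F v /\ exists b, b = G v /\ P a b].
  apply: (@definable_exists _ (fun a v => a = F v /\ exists b, b = G v /\ P a b)).
  apply: definable_and => //.
  apply: (@definable_exists _ (fun b w => b = G (env_tail w) /\ P (w ord0) b)).
  apply: definable_and; first exact: definable_fun_tail.
  (* Under both quantifiers [b] is [x_0] and [a] is [x_1], so the arguments of [P] are swapped. *)
  apply: (definable_rename
    (fun i : 'I_2 => if i == ord0 then lift ord0 ord0 else ord0) dP).
congr definable; apply/seteqP; split=> v /= => [[a [-> [b [-> //]]]]|?].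
by exists (F v); split=> //; exists (G v).
Qed.

Lemma definable_fun_comp1 n (g : M -> M) (F : ('I_n -> M) -> M) :
  definable A [set v : 'I_2 -> M | v ord0 = g (v ord_max)] ->
  definable_fun F -> definable_fun (fun v => g (F v)).
Proof.
move=> dg dF; apply: (@definable_comp2 _ (fun a b => a = g b)) => //.
- exact: definable_fun_var.
- exact: definable_fun_tail.
Qed.

End Definability.

(** * Definability in expansions of the real field *)

Section RealFieldWith.
Context {R : realType}.

Lemma definable_fun_eval (A : structure R) n (t : term A n) :
  definable_fun A (fun v => Defs.eval v t).
Proof.
exists (Equal (Var A ord0) (term_rename (lift ord0) t)).
by apply/seteqP; split=> w /=; rewrite eval_rename.
Qed.

Fixpoint term_transfer (D E : set R) (f g : R -> R) n
    (t : term (real_field_with E g) n) : term (real_field_with D f) n :=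
  match t with
  | Var i => Var _ i
  | Param a => Param _ n a
  | App s ts => @App _ (real_field_with D f) n s
                  (fun i => term_transfer D f (ts i))
  end.

Lemma eval_transfer (D E : set R) (f g : R -> R) n
    (t : term (real_field_with E g) n) v :
  Defs.eval v (term_transfer D f t) = Defs.eval v t.
Proof.
elim: t => //= s ts IH.
by rewrite /finterp /=; congr field_interp; apply/funext => i; rewrite IH.
Qed.

(** Reduces interdefinability to the two graphs: the structures share their function symbols, so
    only the atomic formulas with the relation symbol need a new definition. *)
Lemma definable_transfer (D E : set R) (f g : R -> R) :
  definable (real_field_with D f)
    [set v : 'I_2 -> R | graph_on E g (v ord0, v ord_max)] ->
  forall n (X : set ('I_n -> R)),
    definable (real_field_with E g) X -> definable (real_field_with D f) X.
Proof.
move=> dg n X [h ->{X}].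
elim: h => {n} [n t u|n s ts|n h IH|n h IHh k IHk|n h IH].
- exists (Equal (term_transfer D f t) (term_transfer D f u)).
  by apply/seteqP; split=> v /=; rewrite !eval_transfer.
- apply: (@definable_comp2 _ _ _ (fun a b => graph_on E g (a, b))) => //.
  + have := definable_fun_eval (term_transfer D f (ts ord0)).
    by under eq_fun do rewrite eval_transfer.
  + have := definable_fun_eval (term_transfer D f (ts ord_max)).
    by under eq_fun do rewrite eval_transfer.
- exact: definable_not.
- exact: definable_and.
- apply: (@definable_exists _ _ _ (fun a v => holds h (env_cons a v))).
  by under eq_fun do rewrite env_cons_tail.
Qed.

Section Closure.
Context (D : set R) (f : R -> R) (n : nat).
Let A := real_field_with D f.
Implicit Types F G : ('I_n -> R) -> R.

Lemma definable_fun_op (op : R -> R -> R) F G :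
  definable A [set v : 'I_3 -> R |
    v ord0 = op (v (lift ord0 ord0)) (v (lift ord0 (lift ord0 ord0)))] ->
  definable_fun A F -> definable_fun A G ->
  definable_fun A (fun v => op (F v) (G v)).
Proof.
move=> dop dF dG.
have : definable A [set w : 'I_n.+1 -> R | exists a, a = F (env_tail w) /\
    exists b, b = G (env_tail w) /\ w ord0 = op a b].
  apply: (@definable_exists _ _ _ (fun a w => a = F (env_tail w) /\
    exists b, b = G (env_tail w) /\ w ord0 = op a b)).
  apply: definable_and; first exact: definable_fun_tail.
  apply: (@definable_exists _ _ _ (fun b w => b = G (env_tail (env_tail w)) /\
    w (lift ord0 ord0) = op (w ord0) b)).
  apply: definable_and.
    exact: (definable_fun_tail (definable_fun_tail dG)).
  (* Here [b] is [x_0], [a] is [x_1] and the value of the operation is [x_2]. *)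
  exact: (definable_rename (fun i : 'I_3 =>
    if i == ord0 then lift ord0 (lift ord0 ord0)
    else if i == lift ord0 ord0 then lift ord0 ord0 else ord0) dop).
congr definable; apply/seteqP; split=> w /= => [[a [-> [b [-> //]]]]|->].
by exists (F (env_tail w)); split=> //; exists (G (env_tail w)).
Qed.

Lemma definable_funD F G : definable_fun A F -> definable_fun A G ->
  definable_fun A (fun v => F v + G v).
Proof.
apply: definable_fun_op; exists (Equal (Var A ord0) (@App _ A 3 (FAdd R)
  (fun i => Var A (if i == ord0 then lift ord0 ord0
                   else lift ord0 (lift ord0 ord0))))).
by apply/seteqP; split=> v /=; rewrite /finterp /=.
Qed.

Lemma definable_funM F G : definable_fun A F -> definable_fun A G ->
  definable_fun A (fun v => F v * G v).
Proof.
apply: definable_fun_op; exists (Equal (Var A ord0) (@App _ A 3 (FMul R)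
  (fun i => Var A (if i == ord0 then lift ord0 ord0
                   else lift ord0 (lift ord0 ord0))))).
by apply/seteqP; split=> v /=; rewrite /finterp /=.
Qed.

End Closure.

Section Order.
Context (D : set R) (f : R -> R).
Let A := real_field_with D f.

Lemma definable_funB n (F G : ('I_n -> R) -> R) :
  definable_fun A F -> definable_fun A G ->
  definable_fun A (fun v => F v - G v).
Proof.
move=> dF dG; under eq_fun do rewrite -mulN1r.
by apply: definable_funD => //; apply: definable_funM => //;
  exact: definable_fun_cst.
Qed.

Lemma definable_funV n (F : ('I_n -> R) -> R) :
  definable_fun A F -> definable_fun A (fun v => (F v)^-1).
Proof.
apply: (@definable_fun_comp1 _ _ _ (fun x => x^-1)).
have d0 : definable_fun A (fun v : 'I_2 -> R => v ord0) := definable_fun_var _ _.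
have d1 : definable_fun A (fun v : 'I_2 -> R => v ord_max) := definable_fun_var _ _.
(* The second disjunct accounts for the convention that the inverse of 0 is 0. *)
have := definable_or
  (definable_eq (definable_funM d0 d1) (definable_fun_cst _ _ 1))
  (definable_and (definable_eq d0 (definable_fun_cst _ _ 0))
                 (definable_eq d1 (definable_fun_cst _ _ 0))).
congr definable; apply/seteqP; split=> v /=.
  case=> [v01|[-> ->]]; last by rewrite invr0.
  by apply: divr1_eq; rewrite invrK v01.
move=> ->; have [->|v0] := eqVneq (v ord_max) 0.
  by rewrite invr0; right.
by left; rewrite mulVf.
Qed.

(** The order is not in the signature; a real number is positive exactly when it is the square of a
    nonzero one. *)
Lemma definable_lt n (F G : ('I_n -> R) -> R) :
  definable_fun A F -> definable_fun A G ->
  definable A [set v | F v < G v].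
Proof.
move=> dF dG.
have := @definable_exists _ A n (fun z v => ~ (z = 0) /\ z * z = G v - F v).
have d0 : definable_fun A (fun v : 'I_n.+1 -> R => v ord0) :=
  definable_fun_var _ _.
move=> /(_ (definable_and
  (definable_not (definable_eq d0 (definable_fun_cst _ _ 0)))
  (definable_eq (definable_funM d0 d0)
    (definable_fun_tail (definable_funB dG dF))))).
congr definable; apply/seteqP; split=> v /=.
  by move=> [z [/eqP z0 zz]]; rewrite -subr_gt0 -zz -expr2 exprn_even_gt0.
rewrite -subr_gt0 => FG; exists (Num.sqrt (G v - F v)).
rewrite -expr2 sqr_sqrtr ?(ltW FG)//; split => //.
by apply/eqP; rewrite gt_eqF ?sqrtr_gt0.
Qed.

End Order.

(** The relation symbol knows [f] only on the positive reals. Extending by 0 gives a total function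
    that can be composed freely. *)
Lemma definable_fun_graph (f : R -> R) n (F : ('I_n -> R) -> R) :
  let A := real_field_with `]0, +oo[ f in
  definable_fun A F ->
  definable_fun A (fun v => if 0 < F v then f (F v) else 0).
Proof.
move=> A; apply: (@definable_fun_comp1 _ _ _ (fun x => if 0 < x then f x else 0)).
have d0 : definable_fun A (fun v : 'I_2 -> R => v ord0) := definable_fun_var _ _.
have d1 : definable_fun A (fun v : 'I_2 -> R => v ord_max) := definable_fun_var _ _.
have dR : definable A
    [set v : 'I_2 -> R | graph_on `]0, +oo[ f (v ord_max, v ord0)].
  by exists (@Rel _ A 2 tt (fun i => Var A (if i == ord0 then ord_max else ord0))).
have := definable_or dR
  (definable_and (definable_not (definable_lt (definable_fun_cst _ _ 0) d1))
                 (definable_eq d0 (definable_fun_cst _ _ 0))).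
congr definable; apply/seteqP; rewrite /graph_on /=; split=> v /=.
  rewrite in_itv /= andbT => -[[-> //]|[/negP/negbTE ->//]].
rewrite in_itv /= andbT; case: ifPn => [v0 ->|/negP v0 ->]; first by left.
by right.
Qed.

(** The first hypothesis on [g] determines it from [f] and [L], and [L] is definable from [f]
    because a limit at infinity is expressed by quantifiers over reals. It serves both directions,
    with [Gamma] and [W1] exchanging the roles of [f] and [g]. *)
Lemma definable_graph_of_ratio_limit (f g L : R -> R) (t : R) : 0 < t ->
  (forall x, 0 < x -> g x * (x * L x * f x) = 1) ->
  (forall a, 0 < a ->
    f (t * y + a) * f y / (f (y + a) * f (t * y)) @[y --> +oo] --> L a) ->
  definable (real_field_with `]0, +oo[ f)
    [set v : 'I_2 -> R | graph_on `]0, +oo[ g (v ord0, v ord_max)].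
Proof.
move=> t0 gLf cvgL; set A := real_field_with _ _.
pose f' x := if 0 < x then f x else 0.
pose Q a y := f' (t * y + a) * f' y / (f' (y + a) * f' (t * y)).
have cvgQ a : 0 < a -> Q a y @[y --> +oo] --> L a.
  move=> a0; apply: cvg_trans (cvgL a a0); apply: near_eq_cvg; near=> y.
  have y0 : 0 < y by near: y; exact: nbhs_pinfty_gt.
  by rewrite /Q /f' y0 !addr_gt0 ?mulr_gt0.
(* Squared distances avoid the absolute value, so that the condition uses only field operations and
   the order; [d] stands for the square of the usual epsilon. *)
have limP a l : 0 < a ->
    (forall d, 0 < d -> exists M, forall y, M < y ->
      (Q a y - l) * (Q a y - l) < d) <-> l = L a.
  move=> a0; split=> [H|-> d d0].
    rewrite -(cvg_lim (@Rhausdorff R) (cvgQ _ a0)); apply/esym/cvg_lim => //.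
    apply/cvgrPdist_lt => e e0; have [M HM] := H (e * e) (mulr_gt0 e0 e0).
    near=> y; rewrite -ltr_sqr ?nnegrE ?(ltW e0)//= real_normK ?num_real// !expr2.
    have -> : (l - Q a y) * (l - Q a y) = (Q a y - l) * (Q a y - l) by ring.
    by apply: HM; near: y; exact: nbhs_pinfty_gt (num_real _).
  have /cvgrPdist_lt /(_ (Num.sqrt d)) := cvgQ _ a0.
  rewrite sqrtr_gt0 => /(_ d0) [M [_ HM]]; exists M => y /HM /= H.
  have -> : (Q a y - L a) * (Q a y - L a) = `|L a - Q a y| ^+ 2.
    by rewrite real_normK ?num_real//; ring.
  by rewrite -[ltRHS]sqr_sqrtr ?ltW// ltr_sqr// ?nnegrE// sqrtr_ge0.
have : definable A [set v : 'I_2 -> R | 0 < v ord0 /\ exists l,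
    (forall d, 0 < d -> exists M, forall y, M < y ->
       (Q (v ord0) y - l) * (Q (v ord0) y - l) < d) /\
    v ord_max * (v ord0 * l * f' (v ord0)) = 1].
  have df' n F : definable_fun A F ->
      definable_fun A (fun v : 'I_n -> R => f' (F v)).
    exact: definable_fun_graph.
  apply: definable_and.
    by apply: definable_lt; [exact: definable_fun_cst|exact: definable_fun_var].
  apply: definable_exists; apply: definable_and; last first.
    apply: definable_eq; last exact: definable_fun_cst.
    by repeat apply: definable_funM; try apply: df'; exact: definable_fun_var.
  apply: definable_forall; apply: definable_imp.
    by apply: definable_lt; [exact: definable_fun_cst|exact: definable_fun_var].
  apply: definable_exists; apply: definable_forall; apply: definable_imp.
    by apply: definable_lt; exact: definable_fun_var.
  rewrite /env_tail /Q /=; apply: definable_lt; last exact: definable_fun_var.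
  by repeat first [exact: definable_fun_var | exact: definable_fun_cst
    | apply: definable_funB | apply: definable_funM | apply: definable_funV
    | apply: df' | apply: definable_funD].
congr definable; apply/seteqP; rewrite /graph_on /=.
have f'E x : 0 < x -> f' x = f x by move=> x0; rewrite /f' x0.
have U x : 0 < x -> x * L x * f x != 0.
  by move=> x0; apply: contra_eq_neq (gLf _ x0) => ->; rewrite mulr0 eq_sym oner_eq0.
split=> v /=; rewrite in_itv /= andbT.
  (* Once [l] is known to be the limit, the nonzero factor of [U] can be cancelled, which pins down
     [v ord_max]. *)
  move=> [v0 [l [/limP -/(_ v0) ->]]]; rewrite f'E// => H; split => //.
  by apply: (mulIf (U _ v0)); rewrite H gLf.
move=> [v0 ->]; split => //; exists (L (v ord0)); split; first exact/limP.
by rewrite f'E// gLf.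
Unshelve. all: by end_near. Qed.

End RealFieldWith.

(** * The Gamma function *)

Section GammaIntegral.
Context {R : realType}.
Implicit Types x y a t : R.
Local Notation mu := (@lebesgue_measure R).

Definition gamma_integrand x t : R := t `^ (x - 1) * expR (- t).

(** Extended real values allow the inequality and the functional equation to be proved first;
    finiteness is then deduced from them. *)
Definition gammaE x : \bar R :=
  (\int[mu]_(t in `]0%R, +oo[) (gamma_integrand x t)%:E)%E.

Lemma GammaE x : Gamma x = fine (gammaE x).
Proof. by []. Qed.

Lemma measurable_gamma_integrand x (D : set R) :
  measurable_fun D (gamma_integrand x).
Proof.
apply: measurable_funTS; apply: measurable_funM; first exact: measurable_powR.
exact: measurableT_comp.
Qed.

Lemma gamma_integrand_ge0 x t : 0 <= gamma_integrand x t.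
Proof. by rewrite mulr_ge0 ?powR_ge0 ?expR_ge0. Qed.

Lemma gammaE_ge0 x : (0 <= gammaE x)%E.
Proof. by apply: integral_ge0 => t _; rewrite lee_fin gamma_integrand_ge0. Qed.

Lemma Gamma_ge0 x : 0 <= Gamma x.
Proof. by rewrite GammaE fine_ge0 ?gammaE_ge0. Qed.

(** The integrand is the density of the exponential law of rate 1, of total mass 1. *)
Lemma gammaE1 : gammaE 1 = 1%E.
Proof.
rewrite /gammaE integral_itv_obnd_cbnd; last first.
  by apply/measurable_EFinP; exact: measurable_gamma_integrand.
rewrite -(@integral_exponential_pdf R 1)// integral_mkcond.
apply: eq_integral => t _; rewrite /exponential_pdf !patchE.
case: ifPn => // _.
by rewrite /gamma_integrand subrr powRr0 mulN1r.
Qed.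

(* Weighted AM-GM, from [ln z <= z - 1] at [z = u / w] and [z = 1 / w], where
   [u = t / y] and [w = 1 - a + a * u]. *)
Lemma powR_le_affine y a t : 0 < y -> 0 < t -> 0 <= a <= 1 ->
  t `^ a <= y `^ a * ((1 - a) + a / y * t).
Proof.
move=> y0 t0 /andP[a0 a1]; set u := t / y.
have u0 : 0 < u by rewrite divr_gt0.
have -> : t = y * u by rewrite /u mulrCA divff ?gt_eqF// mulr1.
rewrite powRM ?(ltW y0) ?(ltW u0)// ler_pM2l ?powR_gt0//.
have -> : 1 - a + a / y * (y * u) = 1 - a + a * u.
  by rewrite mulrA divfK ?gt_eqF.
set w := 1 - a + a * u.
have w0 : 0 < w.
  rewrite /w; move: a0; rewrite le_eqVlt => /predU1P[<-|a0].
    by rewrite mul0r subr0 addr0.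
  by rewrite ltr_wpDl ?subr_ge0// mulr_gt0.
have lnle (z : R) : 0 < z -> ln z <= z - 1.
  by move=> z0; rewrite -{1}[z](subrKC 1) le_ln1Dx// ltrBrDr addNr.
rewrite /powR gt_eqF// -ler_ln ?posrE ?expR_gt0// expRK.
have H1 := lnle _ (divr_gt0 u0 w0).
have H2 := lnle _ (divr_gt0 (@ltr01 R) w0).
rewrite ln_div ?posrE// in H1; rewrite ln_div ?posrE// ln1 in H2.
have E : a * (u / w - 1) + (1 - a) * (1 / w - 1) = 0.
  by rewrite /w; field; rewrite gt_eqF.
have := lerD (ler_wpM2l a0 H1) (ler_wpM2l (_ : 0 <= 1 - a) H2).
rewrite subr_ge0 E => /(_ a1); lra.
Qed.

(** Integrate [powR_le_affine] against [t ^ (y - 1) * exp (- t)]; the term linear in [t] produces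
    [gammaE (y + 1)]. *)
Lemma gammaE_le y a : 0 < y -> 0 <= a <= 1 ->
  (gammaE (y + a) <= (y `^ a)%:E *
    ((1 - a)%:E * gammaE y + (a / y)%:E * gammaE (y + 1)))%E.
Proof.
move=> y0 a01; have [a0 a1] := andP a01.
have mg x (D : set R) : measurable_fun D (EFin \o gamma_integrand x).
  by apply/measurable_EFinP; exact: measurable_gamma_integrand.
have g0 x t : (0 <= (gamma_integrand x t)%:E)%E.
  by rewrite lee_fin gamma_integrand_ge0.
have mI : measurable (`]0%R, +oo[%classic : set R) by [].
have a1' : (0 <= (1 - a)%:E)%E by rewrite lee_fin subr_ge0.
have ay : (0 <= (a / y)%:E)%E by rewrite lee_fin divr_ge0// ltW.
rewrite /gammaE -!ge0_integralZl//; [|exact: mg|exact: mg].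
rewrite -ge0_integralD//; last 4 first.
- by move=> t _; rewrite mule_ge0.
- by apply: measurable_funeM; exact: mg.
- by move=> t _; rewrite mule_ge0.
- by apply: measurable_funeM; exact: mg.
rewrite -ge0_integralZl//; last 3 first.
- by apply: emeasurable_funD; apply: measurable_funeM; exact: mg.
- by move=> t _; rewrite adde_ge0// mule_ge0.
- by rewrite lee_fin powR_ge0.
apply: ge0_le_integral => //=.
- exact: mg.
- apply: measurable_funeM; apply: emeasurable_funD;
    apply: measurable_funeM; exact: mg.
move=> t; rewrite in_itv/= andbT => t0.
rewrite -!(EFinM, EFinD) lee_fin /gamma_integrand.
have -> : y + a - 1 = a + (y - 1) by ring.
have -> : y + 1 - 1 = 1 + (y - 1) by ring.
have tn0 : t != 0 by rewrite gt_eqF.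
rewrite !(@powRD _ t _ (y - 1)) ?tn0 ?implybT// powRr1 ?(ltW t0)//.
have := ler_wpM2r (mulr_ge0 (powR_ge0 t (y - 1)) (expR_ge0 (- t)))
  (powR_le_affine y0 t0 a01).
rewrite mulrA => /le_trans; apply.
by rewrite le_eqVlt; apply/orP; left; apply/eqP; ring.
Qed.

(** * The functional equation of Gamma *)

Lemma continuous_powRl x t : 0 < t -> {for t, continuous (@powR R ^~ x)}.
Proof.
move=> t0; apply/differentiable_continuous/derivable1_diffP.
by case: (is_derive1_powR x t0).
Qed.

(** Integration by parts with [t ^ x] and [- exp (- t)], on a compact interval away from 0, where
    [t ^ x] is differentiable. *)
Lemma integral_gamma_integrandS x a b : 0 < x -> 0 < a < b ->
  (\int[mu]_(t in `[a, b]) (gamma_integrand (x + 1) t)%:E =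
   (a `^ x * expR (- a) - b `^ x * expR (- b))%:E +
   \int[mu]_(t in `[a, b]) (x%:E * (gamma_integrand x t)%:E))%E.
Proof.
move=> x0 /andP[a0 ab].
have itv0 t : t \in `[a, b] -> 0 < t.
  by rewrite in_itv /= => /andP[at_ _]; exact: lt_le_trans a0 at_.
have oitv0 t : t \in `]a, b[ -> 0 < t by move/subset_itv_oo_cc/itv0.
have b0 : 0 < b by exact: lt_trans ab.
have cexp t : {for t, continuous (fun t : R => expR (- t))}.
  by apply: continuous_comp; [exact: continuousN|exact: continuous_expR].
have dexp t : is_derive t 1 (fun t : R => - expR (- t)) (expR (- t)).
  apply: is_derive_eq; rewrite /GRing.scale/=; ring.
have := @integration_by_parts R (fun t => t `^ x) (fun t => - expR (- t))
  (fun t => x * t `^ (x - 1)) (fun t => expR (- t)) a b ab.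
rewrite /gamma_integrand addrK => ->.
- rewrite (_ : b `^ x * - expR (- b) - a `^ x * - expR (- a) =
    a `^ x * expR (- a) - b `^ x * expR (- b)); last by ring.
  congr (_ + _)%E.
  transitivity (- (\int[mu]_(t in `[a, b])
      - (x%:E * (t `^ (x - 1) * expR (- t))%:E)))%E.
    by congr (- _)%E; apply: eq_integral => t _; rewrite mulrN EFinN -EFinM mulrA.
  rewrite integral_ge0N ?oppeK// => t _.
  by rewrite lee_fin !mulr_ge0 ?powR_ge0 ?expR_ge0// ltW.
- apply: continuous_in_subspaceT => t /set_mem /itv0 t0.
  apply: cvgM; first exact: cvg_cst.
  exact: continuous_powRl.
- split.
  + by move=> t /oitv0 t0; case: (is_derive1_powR x t0).
  + by apply: cvg_at_right_filter; exact: continuous_powRl.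
  + by apply: cvg_at_left_filter; exact: continuous_powRl.
- move=> t /oitv0 t0; rewrite derive1E.
  by apply: (@derive_val _ _ _ _ _ _ _ (is_derive1_powR x t0)).
- apply: continuous_in_subspaceT => t _; exact: cexp.
- split.
  + by move=> t _; case: (dexp t).
  + by apply: cvg_at_right_filter; apply: cvgN; exact: cexp.
  + by apply: cvg_at_left_filter; apply: cvgN; exact: cexp.
- by move=> t _; rewrite derive1E (@derive_val _ _ _ _ _ _ _ (dexp t)).
Qed.

(* From [ln z <= z - 1] at [z = t / (2 x)]. *)
Lemma powR_expRN_le x t : 0 < x -> 0 < t ->
  t `^ x * expR (- t) <= expR (x * ln (2 * x)) * (2 / t).
Proof.
move=> x0 t0; have x20 : 0 < 2 * x by rewrite mulr_gt0.
have H : ln (t / (2 * x)) <= t / (2 * x).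
  by rewrite ltW// ln_sublinear// divr_gt0.
rewrite ln_div ?posrE// lerBlDr in H.
have {}H : x * ln t - t <= x * ln (2 * x) - t / 2.
  have := ler_wpM2l (ltW x0) H; rewrite mulrDr.
  have -> : x * (t / (2 * x)) = t / 2 by field; rewrite gt_eqF.
  lra.
rewrite /powR (gt_eqF t0) -expRD.
apply: (@le_trans _ _ (expR (x * ln (2 * x) - t / 2))); first by rewrite ler_expR.
rewrite expRD ler_pM2l ?expR_gt0// expRN -[2 / t]invrK lef_pV2 ?posrE ?expR_gt0//.
  rewrite invf_div; apply: le_trans (expR_ge1Dx _); lra.
by rewrite invr_gt0 divr_gt0.
Qed.

(** Integrate by parts on compact intervals exhausting the positive reals; the integrals converge by
    monotone convergence and the boundary terms vanish. *)
Lemma gammaES x : 0 < x -> gammaE (x + 1) = (x%:E * gammaE x)%E.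
Proof.
move=> x0.
(* Starting from 2 keeps the interval nondegenerate at [n = 0], as integration by parts requires. *)
pose I (n : nat) : set R := `[n.+2%:R^-1, n.+2%:R]%classic.
have ndI : {homo I : n m / (n <= m)%N >-> (n <= m)%O}.
  move=> n m nm; apply/subsetPset; rewrite /I; apply: subset_itv => /=.
    by rewrite bnd_simp lef_pV2 ?posrE// ler_nat !ltnS.
  by rewrite bnd_simp ler_nat !ltnS.
have UI : \bigcup_n I n = `]0, +oo[%classic.
  apply/seteqP; split=> t /=.
    move=> [n _]; rewrite /I /= !in_itv /= andbT => /andP[+ _].
    by apply: lt_le_trans; rewrite invr_gt0.
  rewrite in_itv/= andbT => t0.
  pose n := maxn (Num.bound t) (Num.bound t^-1); exists n => //.
  rewrite /I /= in_itv /=; apply/andP; split.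
    rewrite -[t]invrK lef_pV2 ?posrE ?invr_gt0//.
    have tV0 : 0 <= t^-1 by rewrite invr_ge0 ltW.
    by rewrite (le_trans (ltW (archi_boundP tV0)))// ler_nat !leqW// leq_maxr.
  by rewrite (le_trans (ltW (archi_boundP (ltW t0))))// ler_nat !leqW// leq_maxl.
have mg y (D : set R) : measurable_fun D (EFin \o gamma_integrand y).
  by apply/measurable_EFinP; exact: measurable_gamma_integrand.
have g0 y t : (0 <= (gamma_integrand y t)%:E)%E.
  by rewrite lee_fin gamma_integrand_ge0.
have cvgI y : (\int[mu]_(t in I n) (gamma_integrand y t)%:E @[n --> \oo] -->
    gammaE y)%E.
  rewrite /gammaE -UI; apply: ge0_nondecreasing_set_cvg_integral => //.
  - by move=> n; exact: measurable_itv.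
  - by move=> n; exact: mg.
pose c (n : nat) : R := n.+2%:R^-1 `^ x * expR (- n.+2%:R^-1) -
  n.+2%:R `^ x * expR (- n.+2%:R).
have IS n : (\int[mu]_(t in I n) (gamma_integrand (x + 1) t)%:E =
    (c n)%:E + x%:E * \int[mu]_(t in I n) (gamma_integrand x t)%:E)%E.
  rewrite integral_gamma_integrandS//; last first.
    rewrite invr_gt0 ltr0n /= (@lt_trans _ _ 1)//; last by rewrite ltr1n.
    by rewrite invf_lt1// ltr1n.
  rewrite ge0_integralZl//.
  - exact: mg.
  - by rewrite lee_fin ltW.
(* Near 0 the exponential is at most 1 and [t ^ x] tends to 0; at infinity [powR_expRN_le] bounds
   the term by a multiple of [1 / t]. *)
have c0 : c n @[n --> \oo] --> (0 : R).
  rewrite -[0]subr0; apply: cvgB.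
    have h : n.+2%:R^-1 `^ x @[n --> \oo] --> (0 : R).
      have /cvg_at_rightP := powR_cvg0 x0; apply; split.
        by move=> n; rewrite invr_gt0.
      have := @cvg_harmonic R; rewrite -(cvg_shiftS _); exact.
    apply: squeeze_cvgr (cvg_cst 0) h; apply: nearW => n.
    by rewrite mulr_ge0 ?powR_ge0 ?expR_ge0//= ler_piMr ?powR_ge0//
      expR_le1 oppr_le0.
  set C := expR (x * ln (2 * x)).
  have h : C * 2 * n.+2%:R^-1 @[n --> \oo] --> (0 : R).
    rewrite -[X in _ --> X](mulr0 (C * 2)); apply: cvgM; first exact: cvg_cst.
    have := @cvg_harmonic R; rewrite -(cvg_shiftS _); exact.
  apply: squeeze_cvgr (cvg_cst 0) h; apply: nearW => n.
  rewrite mulr_ge0 ?powR_ge0 ?expR_ge0//= -mulrA.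
  exact: powR_expRN_le.
have := cvgI (x + 1); under eq_cvg do rewrite IS.
move=> /cvg_unique; apply; first exact: ereal_hausdorff.
have -> : (x%:E * gammaE x = 0%:E + x%:E * gammaE x)%E by rewrite add0e.
apply: cvgeD.
- by [].
- by apply/cvg_EFin => //; exact: nearW.
- by apply: cvgeZl => //; exact: cvgI.
Qed.

(** * Finiteness, bounds and positivity of Gamma *)

Lemma shift1_nat_frac x : 0 <= x ->
  exists (n : nat) a, 0 <= a <= 1 /\ x + 1 = n.+1%:R + a.
Proof.
move=> x0; have /andP[nx xn] := Num.Theory.truncn_itv x0.
exists (Num.truncn x), (x - (Num.truncn x)%:R); split; last by rewrite -natr1; ring.
by rewrite subr_ge0 nx lerBlDl natr1 ltW.
Qed.

(** On the interval from 1 to 2, [gammaE_le] at [y = 1] bounds by [gammaE 1] and [gammaE 2]. The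
    functional equation carries finiteness up by integers, and back down from [x + 1] to [x]. *)
Lemma gammaE_fin_num x : 0 < x -> gammaE x \is a fin_num.
Proof.
have S y : 0 < y -> (gammaE (y + 1) \is a fin_num) = (gammaE y \is a fin_num).
  move=> y0; rewrite gammaES//; apply/idP/idP => [|yf]; last exact: fin_numM.
  case: (gammaE y) (gammaE_ge0 y) => [r| |]//= _.
  by rewrite mulry gtr0_sg// mul1e.
have H1 a : 0 <= a <= 1 -> gammaE (1 + a) \is a fin_num.
  move=> a01; rewrite ge0_fin_numE ?gammaE_ge0//.
  apply: le_lt_trans (gammaE_le (@ltr01 R) a01) _.
  by rewrite gammaES// gammaE1 !mule1 -!(EFinM, EFinD) ltry.
have Hn (n : nat) a : 0 <= a <= 1 -> gammaE (n.+1%:R + a) \is a fin_num.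
  move=> a01; elim: n => [|n IH]; first by rewrite H1.
  rewrite -natr1 addrAC S// ltr_wpDr//.
  by case/andP: a01.
move=> x0; rewrite -S//.
have [n [a [a01 ->]]] := shift1_nat_frac (ltW x0).
exact: Hn.
Qed.

Lemma GammaS x : 0 < x -> Gamma (x + 1) = x * Gamma x.
Proof. by move=> x0; rewrite GammaE gammaES// fineM// gammaE_fin_num. Qed.

Lemma Gamma1 : Gamma 1 = 1 :> R.
Proof. by rewrite GammaE gammaE1. Qed.

Lemma Gamma_le y a : 0 < y -> 0 <= a <= 1 -> Gamma (y + a) <= y `^ a * Gamma y.
Proof.
move=> y0 a01; have [a0 a1] := andP a01.
have ya0 : 0 < y + a by rewrite ltr_wpDr.
rewrite -lee_fin GammaE fineK ?gammaE_fin_num//.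
apply: le_trans (gammaE_le y0 a01) _.
rewrite gammaES// -[gammaE y]fineK ?gammaE_fin_num// -GammaE
  -!(EFinM, EFinD) lee_fin.
rewrite ler_wpM2l ?powR_ge0// mulrA divfK ?gt_eqF//.
by rewrite -mulrDl subrK mul1r.
Qed.

(** This is [Gamma_le] from [y + a] with step [1 - a], combined with the functional equation. *)
Lemma Gamma_ge y a : 0 < y -> 0 <= a <= 1 ->
  y * Gamma y <= (y + a) `^ (1 - a) * Gamma (y + a).
Proof.
move=> y0 a01; rewrite -GammaS//; have [a0 a1] := andP a01.
have -> : y + 1 = y + a + (1 - a) by ring.
apply: Gamma_le; first by rewrite ltr_wpDr.
by apply/andP; split; lra.
Qed.

Lemma Gamma_nat (n : nat) : 0 < Gamma n.+1%:R :> R.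
Proof.
elim: n => [|n IH]; first by rewrite Gamma1.
by rewrite -natr1 GammaS// mulr_gt0.
Qed.

Lemma Gamma_gt0 x : 0 < x -> 0 < Gamma x :> R.
Proof.
have S y : 0 < y -> (0 < Gamma (y + 1)) = (0 < Gamma y :> R).
  by move=> y0; rewrite GammaS// pmulr_rgt0.
have Hn (n : nat) a : 0 <= a <= 1 -> 0 < Gamma (n.+1%:R + a) :> R.
  (* If [Gamma] vanished here, [Gamma_ge] would force [n.+1%:R * Gamma n.+1%:R], which is positive,
     to be at most 0. *)
  move=> a01; have := Gamma_ge (ltr0Sn R n) a01.
  rewrite lt_neqAle Gamma_ge0 andbT => H; apply/negP => /eqP E.
  by move: H; rewrite -E mulr0 leNgt mulr_gt0// Gamma_nat.
move=> x0; rewrite -S//.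
have [n [a [a01 ->]]] := shift1_nat_frac (ltW x0).
exact: Hn.
Qed.
End GammaIntegral.

(** * Asymptotics and Weierstrass' formula *)

Section Asymptotics.
Context {R : realType}.
Implicit Types x y a t : R.

Definition Gamma_ratio a y : R := Gamma (y + a) / (Gamma y * y `^ a).

Lemma cvg_divy a : a / y @[y --> +oo] --> (0 : R).
Proof.
rewrite -[X in _ --> X](mulr0 a); apply: cvgM; first exact: cvg_cst.
apply/gtr0_cvgV0; first by exists 0; split.
exact: cvg_id.
Qed.

Lemma cvg_1Ddivy a : 1 + a / y @[y --> +oo] --> (1 : R).
Proof.
by rewrite -[X in _ --> X]addr0; apply: cvgD; [exact: cvg_cst|exact: cvg_divy].
Qed.

(** [Gamma_le] bounds the ratio by 1. [Gamma_ge] together with [y ^ a <= (y + a) ^ a] bounds it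
    below by [y / (y + a)], hence by [1 - a / y]. *)
Lemma cvg_Gamma_ratio_le1 a : 0 <= a <= 1 ->
  Gamma_ratio a y @[y --> +oo] --> (1 : R).
Proof.
move=> a01; have [a0 a1] := andP a01.
have h : 1 + - a / y @[y --> +oo] --> (1 : R) by exact: cvg_1Ddivy.
apply: (squeeze_cvgr _ h); last exact: cvg_cst.
near=> y.
have y0 : 0 < y by near: y; exact: nbhs_pinfty_gt.
have ya0 : 0 < y + a by rewrite ltr_wpDr.
have Gy := Gamma_gt0 y0; have Gya := Gamma_gt0 ya0.
rewrite /Gamma_ratio; apply/andP; split; last first.
  by rewrite ler_pdivrMr ?mulr_gt0 ?powR_gt0// mul1r mulrC Gamma_le.
apply: (@le_trans _ _ (y / (y + a))).
  rewrite ler_pdivlMr//.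
  have -> : (1 + - a / y) * (y + a) = y - a ^+ 2 / y by field; rewrite gt_eqF.
  by rewrite gerBl divr_ge0 ?sqr_ge0// ltW.
rewrite ler_pdivlMr ?mulr_gt0 ?powR_gt0// mulrAC ler_pdivrMr//.
have H := Gamma_ge y0 a01.
rewrite mulrA; apply: (@le_trans _ _ ((y + a) `^ (1 - a) * Gamma (y + a) * y `^ a)).
  by rewrite ler_pM2r ?powR_gt0.
rewrite mulrAC mulrC ler_pM2l//.
apply: (@le_trans _ _ ((y + a) `^ (1 - a) * (y + a) `^ a)).
  rewrite ler_pM2l ?powR_gt0//.
  by apply: ge0_ler_powR; rewrite ?nnegrE ?lerDl// ltW.
by rewrite -powRD ?subrK ?powRr1 ?(ltW ya0)// (gt_eqF ya0) implybT.
Unshelve. all: by end_near. Qed.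

(** Induction on the integer part of [a]: raising [a] by 1 multiplies the ratio by [1 + a / y],
    which tends to 1. *)
Lemma cvg_Gamma_ratio a : 0 <= a -> Gamma_ratio a y @[y --> +oo] --> (1 : R).
Proof.
move=> a0; have /andP[na an] := Num.Theory.truncn_itv a0.
have [n [b [b01 ->]]] : exists (n : nat) b, 0 <= b <= 1 /\ a = b + n%:R.
  exists (Num.truncn a), (a - (Num.truncn a)%:R); split; last by ring.
  by rewrite subr_ge0 na lerBlDl natr1 ltW.
elim: n => [|n IH]; first by rewrite addr0; exact: cvg_Gamma_ratio_le1.
have H : (1 + (b + n%:R) / y) * Gamma_ratio (b + n%:R) y @[y --> +oo] --> (1 : R).
  by rewrite -[X in _ --> X](mulr1 1); apply: cvgM IH; exact: cvg_1Ddivy.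
apply: cvg_trans H; apply: near_eq_cvg; near=> y.
have y0 : 0 < y by near: y; exact: nbhs_pinfty_gt.
have c0 : 0 <= b + n%:R by case/andP: b01 => ? _; rewrite addr_ge0.
rewrite /Gamma_ratio -natr1 !addrA GammaS; last by rewrite -addrA ltr_wpDr.
rewrite [y `^ (b + n%:R + 1)]powRD ?(gt_eqF y0) ?implybT// powRr1 ?ltW//=.
have Gy := Gamma_gt0 y0.
field; rewrite !gt_eqF ?powR_gt0//.
Unshelve. all: by end_near. Qed.

(** The expression is the quotient of [Gamma_ratio a] at [t * y] and at [y], times
    [(t * y) ^ a / y ^ a = t ^ a]. *)
Lemma cvg_Gamma_scaled_ratio t a : 0 < t -> 0 < a ->
  Gamma (t * y + a) * Gamma y / (Gamma (y + a) * Gamma (t * y)) @[y --> +oo]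
    --> t `^ a.
Proof.
move=> t0 a0.
have h1 := cvg_Gamma_ratio (ltW a0).
have h2 : Gamma_ratio a (t * y) @[y --> +oo] --> (1 : R).
  apply: (cvg_comp _ _ _ h1); exact: gt0_cvgMry.
have H : Gamma_ratio a (t * y) * (Gamma_ratio a y)^-1 * t `^ a @[y --> +oo]
    --> t `^ a.
  rewrite -[X in _ --> X]mul1r -{1}[1]mul1r -{2}[1]invr1.
  by apply: cvgM (cvg_cst _); apply: cvgM h2 _; exact: cvgV (oner_neq0 R) h1.
apply: cvg_trans H; apply: near_eq_cvg; near=> y.
have y0 : 0 < y by near: y; exact: nbhs_pinfty_gt.
have ty0 : 0 < t * y by rewrite mulr_gt0.
have G1 := Gamma_gt0 y0; have G2 := Gamma_gt0 ty0.
have G3 := Gamma_gt0 (addr_gt0 y0 a0); have G4 := Gamma_gt0 (addr_gt0 ty0 a0).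
have P1 := powR_gt0 a y0; have P2 := powR_gt0 a t0.
rewrite /Gamma_ratio /= powRM ?(ltW t0) ?(ltW y0)//.
move: G1 G2 G3 G4 P1 P2.
move: (Gamma y) (Gamma (t * y)) (Gamma (y + a)) (Gamma (t * y + a)).
move: (y `^ a) (t `^ a) => p q g1 g2 g3 g4 *.
by field; rewrite !gt_eqF.
Unshelve. all: by end_near. Qed.

(** * The Euler-Mascheroni constant and Weierstrass' formula *)

Definition harmonic_sub_ln (N : nat) : R :=
  \sum_(1 <= n < N.+1) n%:R^-1 - ln N.+1%:R.

(** With [ln N.+1%:R] in place of [ln N%:R] the sequence starts at 0 and increases, because
    [ln (1 + u) <= u]; it remains to bound it above. *)
Lemma is_cvg_harmonic_sub_ln : cvgn harmonic_sub_ln.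
Proof.
have S N : harmonic_sub_ln N.+1 =
    harmonic_sub_ln N + (N.+1%:R^-1 - ln (1 + N.+1%:R^-1)).
  rewrite /harmonic_sub_ln big_nat_recr//=.
  have -> : N.+2%:R = N.+1%:R * (1 + N.+1%:R^-1) :> R.
    by rewrite mulrDr mulr1 divff// natr1.
  rewrite lnM ?posrE ?addr_gt0 ?invr_gt0//; ring.
apply: nondecreasing_is_cvgn.
  apply/nondecreasing_seqP => N; rewrite S lerDl subr_ge0 le_ln1Dx//.
  by rewrite (@lt_trans _ _ 0) ?invr_gt0.
exists 1 => _ [N _ <-].
(* This sharper bound is inductive: the increment is at most [1 / (N + 1) - 1 / (N + 2)], which
   telescopes. *)
suff : harmonic_sub_ln N <= 1 - N.+1%:R^-1.
  by move=> /le_trans; apply; rewrite lerBlDr lerDl invr_ge0.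
elim: N => [|N IH]; first by rewrite /harmonic_sub_ln big_geq// ln1 invr1 !subrr.
rewrite S; suff : N.+2%:R^-1 <= ln (1 + N.+1%:R^-1) :> R.
  move: IH; move: (N.+1%:R^-1) (N.+2%:R^-1) => u v.
  move: (ln _) (harmonic_sub_ln N) => l h.
  lra.
have m0 : 0 < N.+1%:R :> R by [].
(* Passing to the inverse turns the required lower bound on [ln] into the upper bound
   [ln (1 + u) <= u], at [u = - 1 / (N + 2)]. *)
have -> : 1 + N.+1%:R^-1 = (1 + - N.+2%:R^-1)^-1 :> R.
  rewrite -(natr1 N.+1); move: (N.+1%:R) m0 => m m0.
  have -> : 1 + - (m + 1)^-1 = m / (m + 1) by field; rewrite gt_eqF// addr_gt0.
  by rewrite invf_div; field; rewrite gt_eqF.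
have m2 : N.+2%:R^-1 < 1 :> R by rewrite invf_lt1// ltr1n.
by rewrite lnV ?posrE ?subr_gt0// lerNr le_ln1Dx// ltrN2.
Qed.

Definition euler_mascheroni : R := limn harmonic_sub_ln.
Local Notation gamma := euler_mascheroni.

(** Each factor is [(x + n) / n], so the functional equation makes the product telescope. *)
Lemma prod_Gamma x (N : nat) : 0 < x ->
  \prod_(1 <= n < N.+1) (1 + x / n%:R) =
  Gamma (x + N.+1%:R) / (Gamma (x + 1) * Gamma N.+1%:R).
Proof.
move=> x0; elim: N => [|N IH].
  by rewrite big_geq// Gamma1 mulr1 divff// gt_eqF// Gamma_gt0// addr_gt0.
have xN : 0 < x + N.+1%:R by rewrite addr_gt0.
rewrite big_nat_recr//= IH -[N.+2%:R]natr1 addrA !GammaS//.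
have G1 := Gamma_gt0 x0; have G2 : 0 < Gamma N.+1%:R :> R := Gamma_gt0 (ltr0Sn R N).
move: G1 G2 xN (ltr0Sn R N).
move: (Gamma x) (Gamma N.+1%:R) (Gamma (x + N.+1%:R)).
move: (N.+1%:R) => m g1 g2 g3 *.
by field; rewrite !gt_eqF//; apply/andP; split.
Qed.

(** By [prod_Gamma] the partial product is [Gamma_ratio x N.+1%:R * exp (- x * harmonic_sub_ln N) /
    Gamma (x + 1)], the logarithm in the exponent cancelling the power in the ratio. Both varying
    factors have known limits. *)
Lemma W1E x : 0 < x -> W1 x = (x * expR (gamma * x) * Gamma x)^-1.
Proof.
move=> x0; apply: cvg_lim => //.
have HG : Gamma_ratio x N.+1%:R @[N --> \oo] --> (1 : R).
  apply: (cvg_comp _ _ _ (cvg_Gamma_ratio (ltW x0))).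
  by rewrite (cvg_shiftS (fun n => n%:R : R)); exact: cvgr_idn.
have HE : expR (- x * harmonic_sub_ln N) @[N --> \oo] --> expR (- x * gamma).
  apply: continuous_cvg; first exact: continuous_expR.
  by apply: cvgM; [exact: cvg_cst|exact: is_cvg_harmonic_sub_ln].
have H : Gamma_ratio x N.+1%:R * expR (- x * harmonic_sub_ln N) *
    (Gamma (x + 1))^-1 @[N --> \oo] --> (x * expR (gamma * x) * Gamma x)^-1.
  have -> : (x * expR (gamma * x) * Gamma x)^-1 =
      1 * expR (- x * gamma) * (Gamma (x + 1))^-1.
    by rewrite GammaS// mul1r mulNr expRN -invfM [x * gamma]mulrC; congr _^-1; ring.
  by apply: cvgM (cvg_cst _); exact: cvgM.
apply: cvg_trans H; apply: near_eq_cvg; apply: nearW => N /=.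
rewrite big_split/= prod_Gamma// -expR_sum sumrN -mulr_sumr.
rewrite /harmonic_sub_ln /Gamma_ratio mulrBr expRB [N.+1%:R + x]addrC.
have -> : expR (- x * ln N.+1%:R) = (N.+1%:R `^ x)^-1.
  by rewrite /powR gt_eqF ?ltr0Sn// mulNr expRN.
rewrite mulNr invrK.
have G1 := Gamma_gt0 (addr_gt0 x0 ltr01).
have G2 : 0 < Gamma N.+1%:R :> R := Gamma_gt0 (ltr0Sn R N).
have P := powR_gt0 x (ltr0Sn R N).
move: G1 G2 P; move: (Gamma _) (Gamma _) (Gamma _) (_ `^ x) (expR _).
by move=> *; field; rewrite !gt_eqF.
Qed.

(** After [W1E] the exponentials cancel, since the arguments in numerator and denominator have the
    same sum. There remain the inverse of the Gamma expression and the linear factors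
    [(1 + a / y) / (1 + a / (t * y))], which tend to 1. *)
Lemma cvg_W1_scaled_ratio t a : 0 < t -> 0 < a ->
  W1 (t * y + a) * W1 y / (W1 (y + a) * W1 (t * y)) @[y --> +oo]
    --> (t `^ a)^-1.
Proof.
move=> t0 a0.
have P2 := powR_gt0 a t0.
have h1 := cvgV (lt0r_neq0 P2) (cvg_Gamma_scaled_ratio t0 a0).
have h2 := cvg_1Ddivy a; have h3 := cvg_1Ddivy (a / t).
have H : (1 + a / y) * (1 + a / t / y)^-1 *
    (Gamma (t * y + a) * Gamma y / (Gamma (y + a) * Gamma (t * y)))^-1
    @[y --> +oo] --> (t `^ a)^-1.
  rewrite -[X in _ --> X]mul1r -[X in X * _^-1](divr1 1).
  apply: cvgM; last exact: h1.
  by apply: cvgM h2 _; apply: cvgV h3; exact: oner_neq0.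
apply: cvg_trans H; apply: near_eq_cvg; near=> y.
have y0 : 0 < y by near: y; exact: nbhs_pinfty_gt.
have ty0 : 0 < t * y by rewrite mulr_gt0.
have ya0 := addr_gt0 y0 a0; have tya0 := addr_gt0 ty0 a0.
have G1 := Gamma_gt0 y0; have G2 := Gamma_gt0 ty0.
have G3 := Gamma_gt0 ya0; have G4 := Gamma_gt0 tya0.
rewrite /= !W1E// !mulrDr !expRD.
have E1 := expR_gt0 (gamma * (t * y)); have E2 := expR_gt0 (gamma * y).
have E3 := expR_gt0 (gamma * a).
move: G1 G2 G3 G4 E1 E2 E3.
move: (Gamma y) (Gamma (t * y)) (Gamma (y + a)) (Gamma (t * y + a)).
move: (expR _) (expR _) (expR _) => e1 e2 e3 g1 g2 g3 g4 *.
by field; rewrite !gt_eqF.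
Unshelve. all: by end_near. Qed.

End Asymptotics.

Theorem mainTheorem2 (R : realType) :
  interdefinable (real_field_with `]0, +oo[ (@W1 R))
                 (real_field_with `]0, +oo[ (@Gamma R)).
Proof.
pose c : R := euler_mascheroni.
have WG x : 0 < x -> W1 x * (x * expR (c * x) * Gamma x) = 1.
  move=> x0; rewrite W1E// mulVf// gt_eqF// !mulr_gt0 ?expR_gt0//.
  exact: Gamma_gt0.
move=> n X; split; apply: definable_transfer.
  (* The graph of [W1] is defined from [Gamma]. *)
  apply: (@definable_graph_of_ratio_limit _ _ _ (fun x => expR (c * x)) (expR c)).
  - exact: expR_gt0.
  - exact: WG.
  - by move=> a a0; rewrite expRM; apply: cvg_Gamma_scaled_ratio => //;
      exact: expR_gt0.
(* The graph of [Gamma] is defined from [W1]; the sign in [t] offsets the inverse in the limit, so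
   [L] is the same. *)
apply: (@definable_graph_of_ratio_limit _ _ _ (fun x => expR (c * x)) (expR (- c))).
- exact: expR_gt0.
- by move=> x x0; rewrite -(WG x)//; ring.
- move=> a a0; have -> : expR (c * a) = (expR (- c) `^ a)^-1.
    by rewrite -expRM mulNr expRN invrK.
  by apply: cvg_W1_scaled_ratio => //; exact: expR_gt0.
Qed.
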